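(* Let $\Gamma$ be an inner amenable discrete group. Then either $\Gamma$ has a non-trivial sofic quotient, or $\Gamma$ is almost commutative.
   Context: A discrete group $\Gamma$ is inner amenable if its conjugation action on $\Gamma\setminus\{1\}$ is amenable, i.e. there is a conjugation-invariant finitely additive probability measure defined on all subsets of $\Gamma\setminus\{1\}$. $\Gamma$ is almost commutative if for every finite subset $\{a_1,\dots,a_k\}\subseteq\Gamma$ there is an element $b\in\Gamma\setminus\{1\}$ commuting with each of $a_1,\dots,a_k$. For $n\ge1$, $S_n$ is the symmetric group on $n$ elements and $\#_{\rm fix}\pi$ is the number of fixed points of $\pi\in S_n$. A group $G$ is sofic if for every real $0<\varepsilon<1$ and every finite subset $F\subseteq G$ there exist a natural number $n\ge 1$ and a function $\phi:G\to S_n$ such that (a) $\#_{\rm fix}(\phi(e)\phi(f)\phi(ef)^{-1})\ge(1-\varepsilon)n$ for all $e,f\in F$; (b) $\phi(1)=1$; (c) $\#_{\rm fix}\phi(e)\le\varepsilon n$ for every $1\ne e\in F$. *)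

(* Defs.v *)
From mathcomp Require Export all_boot all_order all_algebra all_fingroup.
From mathcomp Require Export boolp classical_sets functions cardinality reals.

Set Implicit Arguments.
Unset Strict Implicit.
Unset Printing Implicit Defensive.

Local Open Scope classical_set_scope.
Local Open Scope ring_scope.

(* Only the values of [m] on subsets of [X] are constrained, so [m] stands for a
   function defined on the power set of [X]. *)
Record fin_add_prob (R : realType) (T : Type) (X : set T) (m : set T -> R)
  : Prop := FinAddProb {
  fin_add_prob_ge0 : forall A, A `<=` X -> 0 <= m A;
  fin_add_prob_total : m X = 1;
  fin_add_probU : forall A B, A `<=` X -> B `<=` X -> A `&` B = set0 ->
    m (A `|` B) = m A + m B }.

(* [x ^ g] is [g^-1 * (x * g)]; every [g] being an inverse, invariance under
   these maps is invariance under the left conjugation action. *)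
Definition inner_amenable (R : realType) (G : groupType) : Prop :=
  exists2 m : set G -> R,
    fin_add_prob [set x : G | x != 1%g] m &
    forall (g : G) (A : set G), A `<=` [set x | x != 1%g] ->
      m [set (x ^ g)%g | x in A] = m A.

Definition almost_commutative (G : groupType) : Prop :=
  forall A : set G, finite_set A ->
    exists b : G, b != 1%g /\ forall a, A a -> commute a b.

Definition nfix (n : nat) (s : 'S_n) : nat := #|[set i : 'I_n | s i == i]%SET|.

(* The product of ['S_n] composes from left to right; replacing [phi] by its
   pointwise inverse gives the same notion for the opposite convention. *)
Definition sofic (R : realType) (G : groupType) : Prop :=
  forall eps : R, 0 < eps -> eps < 1 ->
  forall F : set G, finite_set F ->
  exists (n : nat) (phi : G -> 'S_n),
    [/\ (1 <= n)%N,
        forall e f, F e -> F f ->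
          (1 - eps) * n%:R <= (nfix (phi e * phi f * (phi (e * f))^-1)%g)%:R,
        phi 1%g = 1%g
      & forall e, F e -> e != 1%g -> (nfix (phi e))%:R <= eps * n%:R].

(* Quotients of [G] are taken up to isomorphism, as surjective morphisms. *)
Definition has_nontrivial_sofic_quotient (R : realType) (G : groupType) : Prop :=
  exists (Q : groupType) (p : {multiplicative G -> Q}),
    [/\ forall q : Q, exists g : G, p g = q,
        exists q : Q, q != 1%g
      & sofic R Q].

(* Main.v *)
(* Let m be a conjugation-invariant mean on Gamma \ {1}, and let C(g) be the set of
   elements of Gamma \ {1} commuting with g. The elements g with m(C(g)) = 1 form a
   normal subgroup N. If N = Gamma, then any finite intersection of sets C(a) has
   mean 1, hence is nonempty, and Gamma is almost commutative.

   Otherwise Q = Gamma / N is nontrivial, and it is sofic. Day's convexity argument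
   approximates m by a finite multiset in Gamma \ {1} that is almost invariant under
   finitely many conjugations and gives finitely many sets C(g) nearly their mean.
   Conjugation by a lift of q in Q is then close to a permutation of this multiset.
   These permutations are almost multiplicative because elements of N act almost
   trivially, and those of q <> 1 move a proportion of points bounded away from 0;
   passing to a tensor power makes the proportion of fixed points small. *)
From HB Require Import structures.
Require Import Defs.
From mathcomp Require Import generic_quotient ring lra zify.
From mathcomp.multinomials Require Import freeg.

Set Implicit Arguments.
Unset Strict Implicit.
Unset Printing Implicit Defensive.

Import Order.TTheory GRing.Theory Num.Theory.

(** * Quotients of arbitrary groups by normal subgroups *)

Section QuotientGroup.
Local Open Scope quotient_scope.
Local Open Scope group_scope.

(** Cosets are the classes of the relation [N (x * y^-1)]. The operations are computed on chosen
    representatives, and normality makes their classes independent of the choice. *)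
Lemma quotient_group_exists (G : groupType) (N : pred G) :
  N 1 -> (forall x y, N x -> N y -> N (x * y^-1)) -> (forall x g, N x -> N (x ^ g)) ->
  exists (Q : groupType) (p : {multiplicative G -> Q}),
    (forall q, exists g, p g = q) /\ (forall x y, p x = p y <-> N (x * y^-1)).
Proof.
move=> N1 ND NJ.
have NV x : N x -> N x^-1 by move=> /(ND _ _ N1); rewrite mul1g.
have NM x y : N x -> N y -> N (x * y) by move=> Nx /NV Ny; rewrite -[y]invgK; exact: ND.
pose e x y := N (x * y^-1).
have e_refl : reflexive e by move=> x; rewrite /e mulgV.
have e_sym : symmetric e.
  have h x y : e x y -> e y x by move=> /NV; rewrite invgM invgK.
  by move=> x y; apply/idP/idP; exact: h.
have e_trans : transitive e.
  by move=> y x z xy yz; rewrite /e -(divgKA y); exact: NM.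
pose eE := EquivRel e e_refl e_sym e_trans.
pose pi (x : G) : {eq_quot eE} := \pi_{eq_quot eE} x.
have piE x y : pi x = pi y <-> N (x * y^-1) by split=> [/eqmodP|h]; last exact/eqmodP.
have reprK_pi (a : {eq_quot eE}) : pi (repr a) = a by exact: reprK.
have pi_repr x : N (repr (pi x) * x^-1) by apply/piE; rewrite reprK_pi.
pose mulQ (a b : {eq_quot eE}) : {eq_quot eE} := pi (repr a * repr b).
pose invQ (a : {eq_quot eE}) : {eq_quot eE} := pi (repr a)^-1.
have mulE x y : mulQ (pi x) (pi y) = pi (x * y).
  apply/piE; set x' := repr _; set y' := repr _.
  (* The discrepancy is a conjugate of the error on [y] times the error on [x], and both errors lie
     in [N]. *)
  have -> : x' * y' * (x * y)^-1 = (y' * y^-1) ^ x'^-1 * (x' * x^-1).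
    by rewrite /conjg invgK !invgM !mulgA !(mulgVK, mulgK).
  by apply: NM (pi_repr _); apply/NJ/pi_repr.
have invE x : invQ (pi x) = pi x^-1.
  apply/piE; set x' := repr _; rewrite invgK.
  have -> : x'^-1 * x = (x * x'^-1) ^ x' by rewrite /conjg !mulgA mulgVK.
  by apply/NJ; rewrite -[x * x'^-1]invgK; apply/NV; rewrite invgM invgK; exact: pi_repr.
have mulA : associative mulQ.
  by move=> a b c; rewrite -(reprK_pi a) -(reprK_pi b) -(reprK_pi c) !mulE mulgA.
have mul1 : left_id (pi 1) mulQ by move=> a; rewrite -(reprK_pi a) mulE mul1g.
have mulr1 : right_id (pi 1) mulQ by move=> a; rewrite -(reprK_pi a) mulE mulg1.
have mulV : left_inverse (pi 1) invQ mulQ.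
  by move=> a; rewrite -(reprK_pi a) invE mulE mulVg.
have mulrV : right_inverse (pi 1) invQ mulQ.
  by move=> a; rewrite -(reprK_pi a) invE mulE mulgV.
pose Qg := isGroup.Build {eq_quot eE} mulA mul1 mulr1 mulV mulrV.
pose Q : groupType := HB.pack {eq_quot eE} Qg.
have piM : {morph (pi : G -> Q) : x y / x * y} by move=> x y; rewrite -mulE.
pose piQ : {multiplicative G -> Q} := HB.pack (pi : G -> Q) (isMultiplicative.Build G Q pi piM).
exists Q, piQ; split=> [q|x y]; first by exists (repr (q : {eq_quot eE})); exact: reprK_pi.
exact: piE.
Qed.

End QuotientGroup.

Local Open Scope classical_set_scope.
Local Open Scope ring_scope.

(** * Additive minorants and separation *)

(* By Zorn's lemma there is a minimal subadditive q <= p. For each y, the functional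
   x |-> inf_k (q (x + k y) - k q(y)) is again of this kind, so it equals q. *)
Lemma additive_minorant (R : realType) (V : zmodType) (p : V -> R) :
  (forall x y, p (x + y) <= p x + p y) ->
  (forall x n, p x *+ n <= p (x *+ n)) -> p 0 <= 0 ->
  exists f : V -> R, (forall x y, f (x + y) = f x + f y) /\ forall x, f x <= p x.
Proof.
move=> pD pM p0.
(* Subadditivity gives the reverse of the second clause for positive [n], so [S] is sublinearity
   with respect to natural multiples. *)
pose S (q : V -> R) := [/\ forall x y, q (x + y) <= q x + q y,
  forall x n, q x *+ n <= q (x *+ n) & forall x, q x <= p x].
have S0 q : S q -> q 0 = 0.
  case=> _ qM qp; apply/eqP; rewrite eq_le (le_trans (qp 0)) //=.
  by have := qM 0 0%N; rewrite !mulr0n.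
(* This bound, uniform in [q], keeps the infimum over a chain finite. *)
have SN q x : S q -> - p (- x) <= q x.
  move=> Sq; have [qD _ qp] := Sq; have := qD x (- x).
  rewrite subrr (S0 _ Sq); have := qp (- x); lra.
have Sp : S p by split.
pose T := {q : V -> R | S q}.
have : exists q : T, forall r : T, `[< forall x, sval r x <= sval q x >] -> r = q.
  apply: (@Zorn T (fun q r => `[< forall x, sval r x <= sval q x >])).
  - by move=> q; apply/asboolP.
  - move=> q r s /asboolP qr /asboolP rs; apply/asboolP => x.
    exact: le_trans (rs x) (qr x).
  - move=> [q Sq] [r Sr] /asboolP /= qr /asboolP /= rq.
    apply: eq_exist; apply/funext => x.
    by apply/eqP; rewrite eq_le qr rq.
  move=> A Atot; have [[a Aa]|A0] := pselect (exists a, A a); last first.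
    by exists (exist _ p Sp) => s As; case: A0; exists s.
  pose E x := [set sval r x | r in A].
  have Elb x : has_lbound (E x).
    by exists (- p (- x)) => _ [r _ <-]; apply: SN; exact: (svalP r).
  have E0 x : E x !=set0 by exists (sval a x), a.
  have inf_leA r x : A r -> inf (E x) <= sval r x.
    by move=> Ar; apply: ge_inf => //; exists r.
  have Sq : S (fun x => inf (E x)).
    split=> [x y|x n|x] /=.
    - rewrite -lerBlDr; apply: (lb_le_inf (E0 _)) => _ [r Ar <-].
      rewrite lerBlDr -lerBlDl; apply: (lb_le_inf (E0 _)) => _ [s As <-].
      rewrite lerBlDr; case: (Atot _ _ Ar As) => /asboolP rs.
        have [sD _ _] := svalP s.
        apply: le_trans (inf_leA s _ As) _; apply: le_trans (sD _ _) _.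
        by rewrite addrC lerD2l.
      have [rD _ _] := svalP r.
      apply: le_trans (inf_leA r _ Ar) _; apply: le_trans (rD _ _) _.
      by rewrite addrC lerD2r.
    - apply: (lb_le_inf (E0 _)) => _ [r Ar <-]; have [_ rM _] := svalP r.
      by apply: le_trans (rM _ _); rewrite lerMn2r inf_leA ?orbT.
    - have [_ _ ap] := svalP a; exact: le_trans (inf_leA _ _ Aa) (ap x).
  by exists (exist _ _ Sq) => s As; apply/asboolP => x /=; exact: inf_leA.
case=> -[q Sq] qmin; have [qD qM qp] := Sq.
exists q; split=> // x y; apply/eqP; rewrite eq_le qD /=.
pose E z := [set q (z + y *+ k) - q y *+ k | k in [set: nat]].
have Elb z : has_lbound (E z).
  exists (- q (- z)) => _ [k _ <-]; have := qM y k.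
  have := qD (z + y *+ k) (- z); rewrite addrC addrA addNr add0r; lra.
have E0 z : E z !=set0 by exists (q (z + y *+ 0) - q y *+ 0), 0%N.
have inf_leE z k : inf (E z) <= q (z + y *+ k) - q y *+ k.
  by apply: ge_inf => //; exists k.
have infEq z : inf (E z) <= q z by have := inf_leE z 0%N; rewrite addr0 subr0.
have Sinf : S (fun z => inf (E z)).
  split=> [z t|z n|z] /=; last exact: le_trans (infEq _) (qp z).
    rewrite -lerBlDr; apply: (lb_le_inf (E0 _)) => _ [k _ <-].
    rewrite lerBlDr -lerBlDl; apply: (lb_le_inf (E0 _)) => _ [l _ <-].
    rewrite lerBlDr; apply: le_trans (inf_leE _ (k + l)%N) _.
    have := qD (z + y *+ k) (t + y *+ l).
    by rewrite addrACA -mulrnDr => qzt; rewrite [q y *+ (k + l)]mulrnDr; lra.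
  apply: (lb_le_inf (E0 _)) => _ [k _ <-]; case: n => [|n].
    by rewrite !mulr0n add0r subr_ge0 qM.
  have le1 : inf (E z) *+ n.+1 <= (q (z + y *+ k) - q y *+ k) *+ n.+1.
    by rewrite lerMn2r inf_leE.
  (* The [n.+1] copies of [z + y *+ k] contain [k * n] more copies of [y] than wanted; splitting
     them off costs at most [q y *+ (k * n)]. *)
  have qMle l : q (y *+ l) <= q y *+ l.
    elim: l => [|l IHl]; first by rewrite !mulr0n (S0 _ Sq).
    by rewrite !mulrSr; apply: le_trans (qD _ _) _; rewrite lerD2r.
  have := qM (z + y *+ k) n.+1; have := qD (z *+ n.+1 + y *+ k) (y *+ (k * n)).
  have := qMle (k * n)%N; move: le1.
  rewrite mulrnBl mulrnDl -!mulrnA mulnS !mulrnDr addrA; lra.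
have /(congr1 sval) /= /(congr1 (fun r => r x)) /= qE :
    exist _ _ Sinf = exist _ q Sq :> T.
  by apply: qmin; apply/asboolP => z /=.
(* The term [k = 1] of the infimum gives the missing superadditivity. *)
by have := inf_leE x 1%N; rewrite qE !mulr1n lerBrDr.
Qed.

(** Hahn-Banach separation with integer multiples only: averages of [v] stay at distance at least
    [e] from 0. An additive minorant of the functional [p] below is at most [N] (take [n = 1] and
    [s] empty) and at most [- e] at [- v x] (take [n = 1] and [s] reduced to [x]). *)
Lemma separating_additive (R : realType) (V : zmodType) (N : V -> R) :
  (forall x y, N (x + y) <= N x + N y) -> (forall x n, N (x *+ n) = N x *+ n) ->
  (forall x, N (- x) = N x) ->
  forall (X : Type) (v : X -> V) (e : R),
  (forall s : seq X, e *+ size s <= N (\sum_(x <- s) v x)) ->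
  exists f : V -> R, [/\ forall x y, f (x + y) = f x + f y,
    forall z, f z <= N z & forall x, e <= f (v x)].
Proof.
move=> ND NM NN X v e ve.
have N0 : N 0 = 0 by have := NM 0 0%N; rewrite !mulr0n.
(* [p z] is the infimum of [c z (n, s)] over all [n > 0] and [s]. *)
pose c z (ns : nat * seq X) :=
  (N (z *+ ns.1 + \sum_(x <- ns.2) v x) - e *+ size ns.2) / ns.1%:R.
pose E z := [set c z ns | ns in [set ns | (0 < ns.1)%N]].
have Elb z : has_lbound (E z).
  exists (- N z) => _ [[n s] /= n0 <-]; rewrite ler_pdivlMr ?ltr0n // mulr_natr.
  have := ve s; have := ND (z *+ n + \sum_(x <- s) v x) (- (z *+ n)).
  by rewrite addrC addKr NN NM mulNrn; lra.
have E0 z : E z !=set0 by exists (c z (1%N, [::])), (1%N, [::]).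
have inf_leE z n s : (0 < n)%N -> inf (E z) <= c z (n, s).
  by move=> n0; apply: ge_inf => //; exists (n, s).
(* Repeating lists brings fractions over [n] and over [k] to the common denominator [n * k]. *)
have rep k (s : seq X) : exists2 s', size s' = (k * size s)%N &
    \sum_(x <- s') v x = (\sum_(x <- s) v x) *+ k.
  elim: k => [|k [s' ss' vs']]; first by exists [::]; rewrite ?big_nil.
  by exists (s ++ s'); rewrite ?size_cat ?ss' ?big_cat ?mulSn //= vs' mulrS.
have [||| f [fD fE]] := @additive_minorant R V (fun z => inf (E z)).
- move=> y z; rewrite -lerBlDr; apply: (lb_le_inf (E0 _)) => _ [[n s] /= n0 <-].
  rewrite lerBlDr -lerBlDl; apply: (lb_le_inf (E0 _)) => _ [[k t] /= k0 <-].
  have [s' ss' vs'] := rep k s; have [t' tt' vt'] := rep n t.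
  have nk0 : (0 < n * k)%N by rewrite muln_gt0 n0.
  rewrite lerBlDr; apply: le_trans (inf_leE _ (n * k)%N (s' ++ t') nk0) _.
  have n0' : n%:R != 0 :> R by rewrite pnatr_eq0 -lt0n.
  have k0' : k%:R != 0 :> R by rewrite pnatr_eq0 -lt0n.
  rewrite /c /= big_cat /= vs' vt' size_cat ss' tt'.
  rewrite ler_pdivrMr ?ltr0n //.
  set a := N _; set b := N _; set d := N _.
  have -> : ((b - e *+ size t) / k%:R + (d - e *+ size s) / n%:R) * (n * k)%:R
    = b *+ n + d *+ k - e *+ (k * size s + n * size t).
    rewrite mulrDl natrM [X in X + _]mulrCA [X in _ + X]mulrA !divfK //.
    rewrite mulr_natl mulr_natr !mulrnBl -!mulrnA mulrnDr.
    by rewrite [(size t * n)%N]mulnC [(size s * k)%N]mulnC; ring.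
  rewrite lerD2r -!NM addrC; apply: le_trans (ND _ _).
  by rewrite /a !mulrnDl -!mulrnA [(k * n)%N]mulnC addrACA.
- move=> z [|k] /=; apply: (lb_le_inf (E0 _)) => _ [[n s] /= n0 <-].
    by rewrite mulr0n /c /= mul0rn add0r divr_ge0 // subr_ge0.
  have := inf_leE z (k.+1 * n)%N s; rewrite muln_gt0 n0 => /(_ isT) h.
  rewrite -mulr_natr -ler_pdivlMr ?ltr0n //; apply: le_trans h _.
  by rewrite /c /= mulrnA natrM invfM [_^-1 * _]mulrC mulrA.
- apply: le_trans (inf_leE 0 1%N [::] isT) _.
  by rewrite /c /= big_nil mul0rn addr0 N0 mulr0n subrr mul0r.
have f0 : f 0 = 0 by have := fD 0 0; rewrite addr0; lra.
exists f; split=> // [z|x].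
  apply: le_trans (fE z) _; apply: le_trans (inf_leE z 1%N [::] isT) _.
  by rewrite /c /= big_nil addr0 mulr0n subr0 mulr1n divr1.
have := fE (- v x); have := inf_leE (- v x) 1%N [:: x] isT.
rewrite /c /= big_seq1 mulr1n addNr N0 mulr1n sub0r divr1.
have := fD (v x) (- v x); rewrite subrr f0; lra.
Qed.

(** * The l1 norm on finitely supported functions *)

Definition freeg_norm (R : realType) (K : choiceType) (z : {freeg K / R}) : R :=
  \sum_(k <- dom z) `|coeff k z|.

Lemma sum_coeff_le_norm (R : realType) (K : choiceType) (z : {freeg K / R})
    (r : seq K) :
  uniq r -> \sum_(k <- r) `|coeff k z| <= freeg_norm z.
Proof.
move=> r_uniq; rewrite /freeg_norm (bigID (mem (dom z))) /=.
rewrite [X in _ + X]big1 ?addr0; last first.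
  by move=> k /coeff_outdom ->; rewrite normr0.
rewrite [X in _ <= X](bigID (mem r)) /=.
rewrite -[X in X <= _]big_filter -[X in _ <= X + _]big_filter.
have E : perm_eq [seq k <- r | k \in dom z] [seq k <- dom z | k \in r].
  apply: uniq_perm; rewrite ?filter_uniq ?uniq_dom // => k.
  by rewrite !mem_filter andbC.
by rewrite (perm_big _ E) lerDl sumr_ge0.
Qed.

Lemma freeg_normE (R : realType) (K : choiceType) (z : {freeg K / R}) (r : seq K) :
  uniq r -> {subset dom z <= r} -> freeg_norm z = \sum_(k <- r) `|coeff k z|.
Proof.
move=> r_uniq zr; apply/eqP; rewrite eq_le sum_coeff_le_norm // andbT.
rewrite [X in _ <= X](bigID (mem (dom z))) /= -[X in X + _]big_filter.
have E : perm_eq (dom z) [seq k <- r | k \in dom z].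
  apply: uniq_perm; rewrite ?filter_uniq ?uniq_dom // => k.
  by rewrite mem_filter; case: (boolP (k \in dom z)) => // /zr ->.
by rewrite -(perm_big _ E) lerDl sumr_ge0.
Qed.

Lemma freeg_normD (R : realType) (K : choiceType) (y z : {freeg K / R}) :
  freeg_norm (y + z) <= freeg_norm y + freeg_norm z.
Proof.
pose r := undup (dom y ++ dom z).
have r_uniq : uniq r by exact: undup_uniq.
rewrite (@freeg_normE _ _ y r) // ?(@freeg_normE _ _ z r) //; last 2 first.
- by move=> k kz; rewrite mem_undup mem_cat kz orbT.
- by move=> k ky; rewrite mem_undup mem_cat ky.
rewrite (@freeg_normE _ _ (y + z) r) //; last first.
  by move=> k /domD_subset; rewrite mem_undup.
by rewrite -big_split; apply: ler_sum => k _; rewrite coeffD ler_normD.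
Qed.

Lemma freeg_normN (R : realType) (K : choiceType) (z : {freeg K / R}) :
  freeg_norm (- z) = freeg_norm z.
Proof.
rewrite /freeg_norm (perm_big _ (domN_perm_eq z)) /=.
by apply: eq_bigr => k _; rewrite coeffN normrN.
Qed.

Lemma freeg_normMn (R : realType) (K : choiceType) (z : {freeg K / R}) n :
  freeg_norm (z *+ n) = freeg_norm z *+ n.
Proof.
rewrite (@freeg_normE _ _ _ (dom z)) ?uniq_dom //; last first.
  move=> k; rewrite !mem_dom coeffMn; apply: contraNneq => ->.
  by rewrite mul0rn.
rewrite /freeg_norm -sumrMnl; apply: eq_bigr => k _.
by rewrite coeffMn normrMn.
Qed.

Lemma freeg_normU (R : realType) (K : choiceType) (c : R) (k : K) :
  freeg_norm << c *g k >> = `|c|.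
Proof.
have [->|c0] := eqVneq c 0; first by rewrite freegU0 /freeg_norm dom0 big_nil normr0.
by rewrite /freeg_norm domU // big_seq1 coeffU eqxx mulr1.
Qed.

(** * Integration of simple functions against a finitely additive mean *)

Lemma fin_add_prob_set0 (R : realType) (T : Type) (X : set T) (m : set T -> R) :
  fin_add_prob X m -> m set0 = 0.
Proof.
case=> _ _ mU; have := mU set0 set0 (@sub0set _ _) (@sub0set _ _) (set0I _).
by rewrite setU0; lra.
Qed.

Lemma fin_add_probIC (R : realType) (T : Type) (X : set T) (m : set T -> R) A B :
  fin_add_prob X m -> A `<=` X -> m A = m (A `&` B) + m (A `\` B).
Proof.
case=> _ _ mU AX; rewrite -mU ?setDE -?setIUr ?setUv ?setIT //.
- by move=> x [/AX].
- by move=> x [/AX].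
- by rewrite setIACA setICr setI0.
Qed.

(* Induction on [r], splitting [Y] along [B i]. *)
Lemma fin_add_prob_simple (R : realType) (T I : Type) (X : set T) (m : set T -> R)
    (r : seq I) (c : I -> R) (B : I -> set T) (Y : set T) (c0 : R) :
  fin_add_prob X m -> Y `<=` X ->
  (forall x, Y x -> c0 <= \sum_(i <- r) c i * (x \in B i)%:R) ->
  c0 * m Y <= \sum_(i <- r) c i * m (Y `&` B i).
Proof.
move=> Xm; elim: r Y c0 => [|i r IHr] Y c0 YX c0_le.
  rewrite big_nil; have [[x Yx]|Y0] := pselect (exists x, Y x).
    rewrite mulr_le0_ge0 ?(fin_add_prob_ge0 Xm) //.
    by have := c0_le x Yx; rewrite big_nil.
  suff -> : Y = set0 by rewrite (fin_add_prob_set0 Xm) mulr0.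
  by apply/seteqP; split=> // x Yx; case: Y0; exists x.
rewrite big_cons (fin_add_probIC (B i) Xm YX).
have YiX : Y `&` B i `<=` X by move=> x [/YX].
have YDX : Y `\` B i `<=` X by move=> x [/YX].
have /(IHr _ _ YiX) h1 x : (Y `&` B i) x ->
    c0 - c i <= \sum_(i <- r) c i * (x \in B i)%:R.
  by move=> [/c0_le]; rewrite big_cons => + Bx; rewrite mem_set // mulr1; lra.
have /(IHr _ _ YDX) h2 x : (Y `\` B i) x ->
    c0 <= \sum_(i <- r) c i * (x \in B i)%:R.
  by move=> [/c0_le]; rewrite big_cons => + Bx; rewrite memNset // mulr0 add0r.
have -> : \sum_(j <- r) c j * m (Y `&` B j) =
    \sum_(j <- r) c j * m (Y `&` B i `&` B j) +
    \sum_(j <- r) c j * m ((Y `\` B i) `&` B j).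
  rewrite -big_split; apply: eq_bigr => j _ /=; rewrite -mulrDr.
  rewrite (fin_add_probIC (B i) Xm); last by move=> x [/YX].
  rewrite setIAC; congr (c j * (_ + m _)).
  by rewrite !setDE setIAC.
by move: h1 h2; lra.
Qed.

(** A relation between [phi] and its mean [a], so that a presentation of [phi] can be chosen freely
    before its independence of the choice is known. *)
Definition simple_mean (R : realType) (T : Type) (X : set T) (m : set T -> R)
    (phi : T -> R) (a : R) : Prop :=
  exists r : seq (R * set T),
    (forall x, phi x = \sum_(p <- r) p.1 * (x \in p.2)%:R) /\
    a = \sum_(p <- r) p.1 * m (X `&` p.2).

Lemma simple_mean_indic (R : realType) (T : Type) (X : set T) (m : set T -> R)
    (c : R) (B : set T) :
  simple_mean X m (fun x => c * (x \in B)%:R) (c * m (X `&` B)).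
Proof. by exists [:: (c, B)]; split=> [x|]; rewrite big_seq1. Qed.

Lemma simple_meanD (R : realType) (T : Type) (X : set T) (m : set T -> R)
    (phi psi : T -> R) (a b : R) :
  simple_mean X m phi a -> simple_mean X m psi b ->
  simple_mean X m (fun x => phi x + psi x) (a + b).
Proof.
move=> [r [phir ->]] [s [psis ->]]; exists (r ++ s).
by split=> [x|]; rewrite big_cat // phir psis.
Qed.

Lemma simple_mean_sum (R : realType) (T I : Type) (X : set T) (m : set T -> R)
    (r : seq I) (phi : I -> T -> R) (a : I -> R) :
  (forall i, simple_mean X m (phi i) (a i)) ->
  simple_mean X m (fun x => \sum_(i <- r) phi i x) (\sum_(i <- r) a i).
Proof.
move=> phia; elim: r => [|i r IHr].
  by exists [::]; split=> [x|]; rewrite !big_nil.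
rewrite big_cons; have := simple_meanD (phia i) IHr.
by congr (simple_mean _ _ _ _); apply/funext => x; rewrite big_cons.
Qed.

Lemma simple_mean_ge (R : realType) (T : Type) (X : set T) (m : set T -> R)
    (phi : T -> R) (a c : R) :
  fin_add_prob X m -> simple_mean X m phi a -> (forall x, X x -> c <= phi x) ->
  c <= a.
Proof.
move=> Xm [r [phir ->]] c_le.
rewrite -[c]mulr1 -(fin_add_prob_total Xm).
apply: (fin_add_prob_simple Xm) => // x Xx; rewrite -phir; exact: c_le.
Qed.

(** Splitting [n%:R * x] into integer part and remainder bounds [n%:R * |g x - x * g 1|] by 2 for
    arbitrarily large [n]. This restores scalars for the merely additive functional given by
    separation. *)
Lemma additive_bounded_linear (R : realType) (g : R -> R) :
  (forall x y, g (x + y) = g x + g y) -> (forall x, `|g x| <= `|x|) ->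
  forall x, g x = x * g 1.
Proof.
move=> gD gle.
have g0 : g 0 = 0 by have := gD 0 0; rewrite addr0; lra.
have gN x : g (- x) = - g x by have := gD x (- x); rewrite subrr g0; lra.
have gM x n : g (n%:R * x) = n%:R * g x.
  elim: n => [|n IHn]; first by rewrite !mul0r g0.
  by rewrite -natr1 mulrDl mul1r gD IHn mulrDl mul1r.
have g1 : `|g 1| <= 1 by have := gle 1; rewrite normr1.
suff ge0 x : 0 <= x -> g x = x * g 1.
  move=> x; have [/ge0 //|/ltW x0] := leP 0 x.
  by apply: oppr_inj; rewrite -gN -mulNr ge0 // oppr_ge0.
move=> x0; apply/eqP; rewrite -subr_eq0 -normr_le0; apply/ler_addgt0Pl => e e0; rewrite addr0.
have [n n0 en] : exists2 n : nat, (0 < n)%N & 2 <= n%:R * e.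
  exists (Num.truncn (2 / e)).+1 => //; rewrite -ler_pdivrMr //.
  by apply/ltW/truncnS_gt.
have nx0 : 0 <= n%:R * x by rewrite mulr_ge0.
have /andP[] := truncn_itv nx0; set k := Num.truncn _ => kle klt.
have n0' : 0 < n%:R :> R by rewrite ltr0n.
rewrite -(ler_pM2l n0'); apply: le_trans en.
rewrite -[X in X * `|_|](gtr0_norm n0') -normrM mulrBr -gM mulrA.
have -> : n%:R * x = k%:R * 1 + (n%:R * x - k%:R) by ring.
rewrite gD gM; set y := _ - k%:R.
have -> : k%:R * g 1 + g y - (k%:R * 1 + y) * g 1 = g y - y * g 1 by ring.
have y1 : `|y| <= 1 by rewrite ler_norml /y; move: kle klt; rewrite -natr1; lra.
apply: le_trans (ler_normB _ _) _; rewrite normrM.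
have := gle y; have := ler_pM (normr_ge0 y) (normr_ge0 (g 1)) y1 g1; lra.
Qed.

(* The sum is the integer part of [y]. *)
Lemma truncn_layers (R : realType) (y : R) (n : nat) : 0 <= y -> y < n%:R ->
  y - 1 <= \sum_(j < n) (j.+1%:R <= y)%R%:R <= y.
Proof.
move=> y0 yn; have /andP[kle klt] := truncn_itv y0.
suff -> : \sum_(j < n) (j.+1%:R <= y)%R%:R = (Num.truncn y)%:R :> R.
  by rewrite kle lerBlDr natr1 ltW.
have kn : (Num.truncn y <= n)%N.
  by rewrite -(ler_nat R); apply: le_trans kle (ltW yn).
rewrite -natr_sum; congr (_%:R).
transitivity (\sum_(j < n | (j < Num.truncn y)%N) 1)%N.
  rewrite [RHS]big_mkcond /=; apply: eq_bigr => j _.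
  by rewrite truncn_ge_nat //; case: ifP.
by rewrite big_ord_narrow // sum_nat_const card_ord muln1.
Qed.

(** The integer part of [y = n * (h + 1)] is a finite sum of indicators of level sets, each with the
    same mean as its preimage under [al]. So the integer part of [y (al x)] minus that of [y x] has
    mean 0; rounding costs at most 1, which is negligible against a large [n]. *)
Lemma simple_mean_coboundary (R : realType) (T : Type) (X : set T)
    (m : set T -> R) (al : T -> T) (h : T -> R) (n : nat) :
  (forall B, m (X `&` al @^-1` B) = m (X `&` B)) -> (forall x, `|h x| <= 1) ->
  exists2 phi, simple_mean X m phi 0 &
    forall x, n%:R * (h (al x) - h x) - 1 <= phi x.
Proof.
move=> m_al h1; pose y x := n%:R * (h x + 1).
have y0 x : 0 <= y x.
  by rewrite mulr_ge0 //; have := h1 x; rewrite ler_norml => /andP[]; lra.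
(* The value [n * 2] can be attained, hence the successor in this strict bound. *)
have yn x : y x < (n * 2).+1%:R.
  rewrite -natr1 natrM; apply: le_lt_trans (_ : n%:R * 2 < _); last lra.
  by rewrite ler_wpM2l //; have := h1 x; rewrite ler_norml => /andP[]; lra.
pose B (j : nat) := [set x | j.+1%:R <= y x].
have sm (j : 'I_(n * 2).+1) := simple_meanD
  (simple_mean_indic X m 1 (al @^-1` B j)) (simple_mean_indic X m (-1) (B j)).
have := simple_mean_sum (index_enum _) sm.
rewrite [X in simple_mean _ _ _ X]big1 => [|j _]; last first.
  by rewrite m_al mulN1r mul1r subrr.
move=> {}sm; eexists; first exact: sm.
move=> x /=; under eq_bigr do rewrite mul1r mulN1r; rewrite sumrB.
have /andP[+ _] := truncn_layers (y0 (al x)) (yn (al x)).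
have /andP[_ +] := truncn_layers (y0 x) (yn x).
have inB z j : (z \in B j) = (j.+1%:R <= y z).
  by apply/idP/idP => [/set_mem|?]; last exact: mem_set.
have inalB z j : (z \in al @^-1` B j) = (j.+1%:R <= y (al z)).
  by apply/idP/idP => [/set_mem|?]; last exact: mem_set.
under [X in _ -> _ -> _ <= X - _]eq_bigr do rewrite inalB.
under [X in _ -> _ -> _ <= _ - X]eq_bigr do rewrite inB.
by rewrite /y; lra.
Qed.

(* Otherwise the vectors [v x] below are separated from 0 in l1, which gives bounded
   functions [h i] and constants [t i = f << inr i >>] such that
   [sum_i (h i (al i x) - h i x + t i * (1_(A i) x - m (A i))) >= d] on [X];
   but the left-hand side has mean 0. *)
Lemma almost_invariant_seq (R : realType) (T I : choiceType) (X : set T)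
    (m : set T -> R) (r : seq I) (al : I -> T -> T) (A : I -> set T) (d : R) :
  fin_add_prob X m -> uniq r ->
  (forall i B, m (X `&` al i @^-1` B) = m (X `&` B)) ->
  (forall i, A i `<=` X) -> 0 < d ->
  exists s : seq T, [/\ (0 < size s)%N, forall x, x \in s -> X x &
    forall i, i \in r ->
      (forall ys : seq T, uniq ys -> \sum_(y <- ys)
        `|(count_mem y (map (al i) s))%:R - (count_mem y s)%:R| <= d *+ size s) /\
      `|(count (fun x => x \in A i) s)%:R - m (A i) *+ size s| <= d *+ size s].
Proof.
move=> Xm r_uniq m_al AX d0.
(* Summed over a list, coordinate [inl (i, y)] of [w i x] is the change of the multiplicity of [y]
   under [al i], and coordinate [inr i] is the deviation of the count of [A i] from its expected
   value. *)
pose K : choiceType := ((I * T) + I)%type.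
pose w i x : {freeg K / R} := << inl (i, al i x) >> - << inl (i, x) >> +
  << ((x \in A i)%:R - m (A i)) *g inr i >>.
pose v (x : {x : T | x \in X}) := \sum_(i <- r) w i (val x).
have [s s_lt] : exists s : seq {x | x \in X},
    freeg_norm (\sum_(x <- s) v x) < d *+ size s.
  apply: contrapT => /forallNP no_s.
  have [|f [fD fN fv]] := @separating_additive R {freeg K / R} (@freeg_norm R K)
    (@freeg_normD R K) (fun x n => freeg_normMn x n) (@freeg_normN R K) _ v d.
    by move=> s; rewrite leNgt; apply/negP; exact: no_s.
  have f0 : f 0 = 0 by have := fD 0 0; rewrite addr0; lra.
  have fNE z : f (- z) = - f z by have := fD z (- z); rewrite subrr f0; lra.
  have fabs z : `|f z| <= freeg_norm z.
    by rewrite ler_norml fN andbT lerNl -fNE -(freeg_normN z) fN.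
  pose h i x := f << inl (i, x) >>.
  have h1 i x : `|h i x| <= 1 by apply: le_trans (fabs _) _; rewrite freeg_normU normr1.
  have lin i c : f << c *g inr i >> = c * f << inr i >>.
    apply: (@additive_bounded_linear R (fun c => f << c *g inr i >>)) => [x y|x].
      by rewrite -freegUD fD.
    by apply: le_trans (fabs _) _; rewrite freeg_normU.
  have fw x : X x -> d <= \sum_(i <- r) (h i (al i x) - h i x +
      ((x \in A i)%:R - m (A i)) * f << inr i >>).
    move=> Xx; have := fv (exist _ x (mem_set Xx)); rewrite /v (big_morph f fD f0) /=.
    by under eq_bigr do rewrite /w fD fD fNE lin.
  (* After scaling by [n], each of the [size r] coboundaries loses 1 to rounding; this [n] keeps the
     total loss below the gap [n%:R * d], which contradicts mean 0. *)
  pose n := (Num.truncn ((size r)%:R / d)).+1.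
  have nd : (size r)%:R < n%:R * d by rewrite -ltr_pdivrMr // truncnS_gt.
  have /choice[phi phiP] : forall i, exists phi, simple_mean X m phi 0 /\
      forall x, n%:R * (h i (al i x) - h i x) - 1 <= phi x.
    move=> i; have [phi ? ?] := simple_mean_coboundary n (m_al i) (h1 i).
    by exists phi.
  pose psi i x := phi i x + (n%:R * f << inr i >>) * (x \in A i)%:R.
  have smi i : simple_mean X m (psi i) (0 + (n%:R * f << inr i >>) * m (X `&` A i)).
    by apply: simple_meanD; [case: (phiP i)|exact: simple_mean_indic].
  have sm := simple_mean_sum r smi.
  have := simple_mean_ge
    (c := n%:R * d - (size r)%:R + \sum_(i <- r) n%:R * f << inr i >> * m (A i)) Xm sm.
  have -> : \sum_(i <- r) (0 + (n%:R * f << inr i >>) * m (X `&` A i)) =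
      \sum_(i <- r) n%:R * f << inr i >> * m (A i).
    by apply: eq_bigr => i _; rewrite add0r setIidr.
  suff h2 x : X x -> n%:R * d - (size r)%:R +
      \sum_(i <- r) n%:R * f << inr i >> * m (A i) <= \sum_(i <- r) psi i x.
    by move=> /(_ h2); lra.
  move=> /fw; rewrite -(ler_pM2l (_ : 0 < n%:R)) ?ltr0n // mulr_sumr => dle.
  have -> : (size r)%:R = \sum_(i <- r) 1 :> R.
    by rewrite big_const_seq count_predT iter_addr addr0.
  rewrite -addrA -lerBrDr; apply: le_trans dle _.
  rewrite opprD opprK -!sumrN -!big_split /=; apply: ler_sum => i _.
  rewrite /psi; have [_ /(_ x)] := phiP i; lra.
exists (map val s); split.
(* The strict inequality [s_lt] excludes the empty list. *)
- rewrite size_map; case: s s_lt => //=; rewrite big_nil mulr0n.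
  by rewrite ltNge sumr_ge0.
- by move=> x /mapP[y _ ->]; apply: set_mem; exact: (valP y).
move=> i ir; rewrite size_map.
have coef k : coeff k (\sum_(x <- s) v x) =
    \sum_(j <- r) \sum_(x <- map val s) coeff k (w j x).
  rewrite raddf_sum exchange_big /= big_map; apply: eq_bigr => x _.
  by rewrite raddf_sum.
have coefl y : coeff (inl (i, y)) (\sum_(x <- s) v x) =
    (count_mem y (map (al i) (map val s)))%:R - (count_mem y (map val s))%:R.
  rewrite coef (bigD1_seq i) //= [X in _ + X]big1 ?addr0; last first.
    move=> j ji; apply: big1 => x _; rewrite /w !coeffD coeffN !coeffU.
    by rewrite !(inj_eq inl_inj) !xpair_eqE (negPf ji) /= !mulr0 subrr addr0.
  elim: (map val s) => [|x l IHl]; first by rewrite big_nil subrr.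
  rewrite big_cons IHl /w !coeffD coeffN !coeffU.
  rewrite !(inj_eq inl_inj) !xpair_eqE eqxx /= !natrD; lra.
have coefr : coeff (inr i) (\sum_(x <- s) v x) =
    (count (fun x => x \in A i) (map val s))%:R - m (A i) *+ size s.
  rewrite coef (bigD1_seq i) //= [X in _ + X]big1 ?addr0; last first.
    move=> j ji; apply: big1 => x _; rewrite /w !coeffD coeffN !coeffU.
    by rewrite !(inj_eq inr_inj) (negPf ji) /= !mulr0 subrr addr0.
  rewrite -(size_map val); elim: (map val s) => [|x l IHl].
    by rewrite big_nil subrr.
  rewrite big_cons IHl /w !coeffD coeffN !coeffU.
  by rewrite !(inj_eq inr_inj) eqxx /= !natrD !mulrS; lra.
split=> [ys ys_uniq|].
  apply: le_trans (ltW s_lt); under eq_bigr do rewrite -coefl.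
  rewrite -(big_map (fun y => inl (i, y)) predT
    (fun k => `|coeff k (\sum_(x <- s) v x)|)).
  by apply: sum_coeff_le_norm; rewrite map_inj_uniq // => y z [].
apply: le_trans (ltW s_lt); rewrite -coefr.
have := @sum_coeff_le_norm R K (\sum_(x <- s) v x) [:: inr i] isT.
by rewrite big_seq1.
Qed.

(** * Multisets and permutations *)

(** The complements of [A] and [f @: A] have equal size, so the remaining points are matched by
    their ranks in the two enumerations. *)
Lemma perm_extension (T : finType) (A : {set T}) (f : T -> T) :
  {in A &, injective f} -> exists s : {perm T}, {in A, s =1 f}.
Proof.
move=> f_inj; pose e x := nth x (enum (~: (f @: A))) (index x (enum (~: A))).
have e_lt x : x \notin A -> (index x (enum (~: A)) < size (enum (~: (f @: A))))%N.
  move=> xA; rewrite -cardE cardsCs finset.setCK card_in_imset //.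
  by rewrite -(finset.setCK A) -cardsCs cardE finset.setCK index_mem mem_enum inE.
pose g x := if x \in A then f x else e x.
have eA x : x \notin A -> e x \notin f @: A.
  by move=> /e_lt /(mem_nth x); rewrite mem_enum inE.
have g_inj : injective g.
  move=> x y; rewrite /g; case: ifPn => xA; case: ifPn => yA.
  - exact: f_inj.
  - by move=> fe; have := eA _ yA; rewrite -fe imset_f.
  - by move=> fe; have := eA _ xA; rewrite fe imset_f.
  - rewrite /e (set_nth_default y) ?e_lt // => /eqP.
    rewrite nth_uniq ?enum_uniq ?e_lt // => /eqP ixy.
    by rewrite -(nth_index x (_ : x \in enum (~: A))) ?ixy ?nth_index ?mem_enum ?inE.
by exists (perm g_inj) => x xA; rewrite permE /g xA.
Qed.

(* Turns a multiset into a set by numbering the copies of each element, so that a map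
   moving the multiset little is close to a permutation of a set. *)
Definition numbered (T : eqType) (s : seq T) : seq (T * nat) :=
  [seq (x, k) | x <- undup s, k <- iota 0 (count_mem x s)].

Lemma numbered_uniq (T : eqType) (s : seq T) : uniq (numbered s).
Proof.
apply: allpairs_uniq_dep => [|x _|]; rewrite ?undup_uniq ?iota_uniq //.
by move=> [x k] [y l] _ _ /= [-> ->].
Qed.

Lemma mem_numbered (T : eqType) (s : seq T) x k :
  ((x, k) \in numbered s) = (k < count_mem x s)%N.
Proof.
apply/allpairsPdep/idP => [[y [l [_ + [-> ->]]]]|kx].
  by rewrite mem_iota.
exists x, k; rewrite mem_undup mem_iota /= add0n kx; split=> //.
by rewrite -has_pred1 has_count; apply: leq_ltn_trans kx.
Qed.

Lemma perm_numbered (T : eqType) (s : seq T) :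
  perm_eq [seq p.1 | p <- numbered s] s.
Proof.
rewrite -[X in perm_eq _ X]/(id s); apply: perm_trans (perm_count_undup s).
rewrite /numbered map_flatten -map_comp; apply/seq.permP => a.
congr (count a (flatten _)); apply: eq_map => x /=; rewrite -map_comp /=.
elim: (count_mem x s) 0%N => //= n IHn k; by rewrite IHn.
Qed.

(** If [x] and [al x] occur [a] and [b] times in [s], the copies of [x] without a target are those
    numbered from [b] to [a - 1]. By injectivity [a] is also the multiplicity of [al x] in
    [map al s]. *)
Lemma count_numbered_le (R : realType) (T : eqType) (s : seq T) (al : T -> T) :
  injective al ->
  (count (fun p => (al p.1, p.2) \notin numbered s) (numbered s))%:R <=
  \sum_(y <- undup (map al s))
    `|(count_mem y (map al s))%:R - (count_mem y s)%:R| :> R.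
Proof.
move=> al_inj; rewrite undup_map_inj // big_map.
rewrite {2}/numbered count_flatten sumnE !big_map natr_sum.
apply: ler_sum => x _.
have -> : count_mem (al x) (map al s) = count_mem x s.
  by rewrite count_map; apply: eq_count => y /=; rewrite (inj_eq al_inj).
rewrite count_map (@eq_count _ _ (fun k => (count_mem (al x) s <= k)%N)); last first.
  by move=> k /=; rewrite mem_numbered -leqNgt.
set a := count_mem x s; set b := count_mem (al x) s.
have -> : (count (fun k => b <= k) (iota 0 a) = a - b)%N.
  elim: a => [|a IHa]; first by rewrite sub0n.
  rewrite -addn1 iotaD count_cat IHa /= add0n addn0.
  by case: leqP => h; lia.
have [ba|ab] := leqP b a; first by rewrite natrB // ler_norm.
by have /eqP -> := ltnW ab; exact: normr_ge0.
Qed.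

(** [u] lists the numbered copies. Acting on first coordinates, [al] is a partial injection of the
    indices, defined where the image is again listed; [perm_extension] completes it and
    [count_numbered_le] bounds the indices left out. *)
Lemma multiset_model (R : realType) (T : choiceType) (s : seq T) :
  exists u : 'I_(size s) -> T * nat, [/\ injective u,
    forall i, (u i).1 \in s,
    forall P : pred T, #|[set i | P (u i).1]%SET| = count P s &
    forall al : T -> T, injective al -> exists sg : 'S_(size s),
      #|[set i | u (sg i) != (al (u i).1, (u i).2)]%SET|%:R <=
      \sum_(y <- undup (map al s))
        `|(count_mem y (map al s))%:R - (count_mem y s)%:R| :> R].
Proof.
have sz : size (numbered s) = size s.
  by rewrite -(perm_size (perm_numbered s)) size_map.
pose t := tcast sz (in_tuple (numbered s)).
have tE : t = numbered s :> seq _ by rewrite val_tcast.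
pose u := tnth t.
have u_inj : injective u by apply/tuple_uniqP; rewrite tE numbered_uniq.
have cardu (P : pred (T * nat)) : #|[set i | P (u i)]%SET| = count P (numbered s).
  rewrite cardsE cardE size_filter -tE -[in RHS](map_tnth_enum t) count_map.
  rewrite enumT; exact: eq_count.
exists u; split=> // [i|P|al al_inj].
- rewrite -(perm_mem (perm_numbered s)) map_f // -tE; exact: mem_tnth.
- have /seq.permP <- := perm_numbered s; rewrite count_map; exact: cardu.
pose be (p : T * nat) := (al p.1, p.2).
have be_inj : injective be by move=> [x k] [y l] [/al_inj -> ->].
pose A := [set i | be (u i) \in t]%SET.
have /fin_all_exists[f fP] (i : 'I_(size s)) :
    exists j, i \in A -> u j = be (u i).
  have [|_] := boolP (i \in A); last by exists i.
  by rewrite inE => /tnthP[j ->]; exists j.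
have [|sg sgP] := @perm_extension _ A f.
  by move=> i j iA jA fij; apply/u_inj/be_inj; rewrite -!fP // fij.
exists sg; apply: le_trans (count_numbered_le R s al_inj).
rewrite -cardu ler_nat; apply/subset_leq_card/fintype.subsetP => i.
rewrite !inE; apply: contraNN; rewrite -tE => iA.
have iA' : i \in A by rewrite inE.
by rewrite sgP // fP.
Qed.

(** * Amplification *)

Section PowerPerm.
Variables n k : nat.
Local Notation tup := {ffun 'I_k -> 'I_n}.

(** The tensor power: [s] acts coordinatewise on [k]-tuples, transported to ordinals because [sofic]
    takes values in permutations of ordinals. *)
Definition power_perm_fun (s : 'S_n) (i : 'I_#|tup|) : 'I_#|tup| :=
  enum_rank [ffun j => s (enum_val i j)].

Lemma power_perm_fun_inj s : injective (power_perm_fun s).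
Proof.
move=> i i' /enum_rank_inj /ffunP h; apply/enum_val_inj/ffunP => j.
by have := h j; rewrite !ffunE => /perm_inj.
Qed.

Definition power_perm s : 'S_#|tup| := perm (@power_perm_fun_inj s).

Lemma power_permM : {morph power_perm : s t / (s * t)%g}.
Proof.
move=> s t; apply/permP => i; rewrite permM !permE /power_perm_fun.
by congr enum_rank; apply/ffunP => j; rewrite !ffunE enum_rankK ffunE permM.
Qed.

Lemma power_perm1 : power_perm 1%g = 1%g.
Proof.
apply/permP => i; rewrite perm1 permE /power_perm_fun -[RHS]enum_valK.
by congr enum_rank; apply/ffunP => j; rewrite ffunE perm1.
Qed.

Lemma power_permV s : power_perm s^-1%g = (power_perm s)^-1%g.
Proof. by apply/eqP; rewrite eq_sym eq_invg_mul -power_permM mulgV power_perm1. Qed.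

(** A tuple is fixed exactly when each of its coordinates is. *)
Lemma nfix_power_perm s : nfix (power_perm s) = (nfix s ^ k)%N.
Proof.
rewrite /nfix -[k in RHS]card_ord -card_ffun_on -(card_imset _ enum_val_inj).
apply: eq_card => f; apply/imsetP/ffun_onP => [[i + ->] j|fs].
  rewrite !inE permE => /eqP/(congr1 enum_val); rewrite enum_rankK.
  by move=> /ffunP/(_ j); rewrite ffunE => ->.
exists (enum_rank f); rewrite ?enum_rankK // inE permE /power_perm_fun enum_rankK.
by apply/eqP; congr enum_rank; apply/ffunP => j; have := fs j; rewrite ffunE inE => /eqP.
Qed.

End PowerPerm.

Lemma bernoulli_le (R : realType) (x : R) (k : nat) :
  x <= 1 -> 1 - k%:R * x <= (1 - x) ^+ k.
Proof.
move=> x1; elim: k => [|k IHk]; first by rewrite mul0r subr0 expr0.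
rewrite exprS -natr1; have x0 : 0 <= 1 - x by rewrite subr_ge0.
apply: le_trans (ler_wpM2l x0 IHk).
have := mulr_ge0 (ler0n R k) (sqr_ge0 x); rewrite expr2; lra.
Qed.

(** By induction [x ^+ k * (1 + k%:R * (1 - x)) <= 1], so the powers decay at least like a multiple
    of [1 / k]. *)
Lemma expr_lt1_small (R : realType) (x e : R) :
  0 <= x -> x < 1 -> 0 < e -> exists2 k : nat, (0 < k)%N & x ^+ k <= e.
Proof.
move=> x0 x1 e0; have t0 : 0 < 1 - x by rewrite subr_gt0.
have decay k : x ^+ k * (1 + k%:R * (1 - x)) <= 1.
  elim: k => [|k IHk]; first by rewrite expr0 mul0r addr0 mul1r.
  rewrite exprSr -mulrA -natr1; apply: le_trans IHk.
  apply: ler_wpM2l; first exact: exprn_ge0.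
  have := mulr_ge0 (ler0n R k) (sqr_ge0 (1 - x)).
  by have := sqr_ge0 (1 - x); rewrite !expr2; lra.
exists (Num.truncn (e^-1 / (1 - x))).+1 => //; set k := _.+1.
have ke : e^-1 <= k%:R * (1 - x).
  by rewrite -ler_pdivrMr //; apply/ltW/truncnS_gt.
have d0 : 0 < 1 + k%:R * (1 - x) by apply: ltr_wpDl => //; apply: mulr_gt0.
have := decay k; rewrite -ler_pdivlMr // div1r => /le_trans; apply.
rewrite -[e]invrK lef_pV2 ?posrE ?invr_gt0 //; lra.
Qed.

(** A tensor power with exponent [k] turns the fixed-point bound [c] into [c ^+ k <= eps], while
    Bernoulli's inequality keeps [(1 - eps / k) ^+ k] above [1 - eps]. As [k] depends on [c] and
    [d = eps / k], the bound [c] has to be given before [d]. *)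
Lemma sofic_amplification (R : realType) (G : groupType) :
  (forall F : set G, finite_set F -> exists2 c : R, c < 1 &
    forall d : R, 0 < d -> exists (n : nat) (phi : G -> 'S_n),
    [/\ (1 <= n)%N,
        forall e f, F e -> F f ->
          (1 - d) * n%:R <= (nfix (phi e * phi f * (phi (e * f))^-1)%g)%:R,
        phi 1%g = 1%g
      & forall e, F e -> e != 1%g -> (nfix (phi e))%:R <= c * n%:R]) ->
  sofic R G.
Proof.
move=> weak eps eps0 eps1 F /weak[c c1 {}weak].
(* The given [c] may be negative, and powers are compared only for nonnegative bases. *)
pose c' := Num.max 0 c; have c'1 : c' < 1 by rewrite gt_max ltr01.
have c'0 : 0 <= c' by rewrite le_max lexx.
have [k k0 ck] := expr_lt1_small c'0 c'1 eps0.
have k0' : 0 < k%:R :> R by rewrite ltr0n.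
have d0 : 0 < eps / k%:R by rewrite divr_gt0.
have d1 : eps / k%:R <= 1.
  by rewrite ler_pdivrMr // mul1r (le_trans (ltW eps1)) // ler1n.
have [n [phi [n0 phiM phi1 phiF]]] := weak _ d0.
exists #|{ffun 'I_k -> 'I_n}|, (fun g => power_perm k (phi g)).
have cardE : #|{ffun 'I_k -> 'I_n}| = (n ^ k)%N by rewrite card_ffun !card_ord.
split=> [|e f Fe Ff||e Fe e1].
- by rewrite cardE expn_gt0 n0.
- rewrite -power_permM -power_permV -power_permM nfix_power_perm cardE !natrX.
  apply: le_trans (_ : (1 - eps / k%:R) ^+ k * n%:R ^+ k <= _).
    rewrite ler_wpM2r ?exprn_ge0 //; apply: le_trans (bernoulli_le k d1).
    by rewrite mulrC divfK // gt_eqF.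
  rewrite -exprMn; apply: lerXn2r; rewrite ?nnegrE ?phiM //.
  by rewrite mulr_ge0 // subr_ge0.
- by rewrite phi1 power_perm1.
- rewrite nfix_power_perm cardE !natrX.
  apply: le_trans (_ : c' ^+ k * n%:R ^+ k <= _); last first.
    by rewrite ler_wpM2r ?exprn_ge0.
  rewrite -exprMn; apply: lerXn2r; rewrite ?nnegrE ?mulr_ge0 //.
  by apply: le_trans (phiF e Fe e1) _; rewrite ler_wpM2r // le_max lexx orbT.
Qed.

(** * The sofic quotient *)

Definition centralizer1 (G : groupType) (g : G) : set G :=
  [set x | x != 1%g /\ commute g x].

Lemma conjg_id_commute (G : groupType) (x g : G) : (x ^ g)%g = x <-> commute g x.
Proof.
split=> [/conjg_fixP/commgP|gx]; first exact: commute_sym.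
by apply/conjg_fixP/commgP/commute_sym.
Qed.

Lemma fin_add_prob_le (R : realType) (T : Type) (X : set T) (m : set T -> R) A B :
  fin_add_prob X m -> A `<=` B -> B `<=` X -> m A <= m B.
Proof.
move=> Xm AB BX; rewrite (fin_add_probIC A Xm BX) (setIidr AB) lerDl.
by apply: (fin_add_prob_ge0 Xm) => x [/BX].
Qed.

(** The part of [A] outside [B] lies in the complement of [B] in [X], which has mean 0. *)
Lemma fin_add_prob_setI1 (R : realType) (T : Type) (X : set T) (m : set T -> R) A B :
  fin_add_prob X m -> A `<=` X -> B `<=` X -> m A = 1 -> m B = 1 -> m (A `&` B) = 1.
Proof.
move=> Xm AX BX mA mB; have := fin_add_probIC B Xm AX.
have := fin_add_probIC B Xm (@subset_refl _ X); rewrite (setIidr BX) mB.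
rewrite (fin_add_prob_total Xm) mA => XD.
have : m (A `\` B) <= m (X `\` B).
  by apply: fin_add_prob_le Xm _ _ => x [] => [/AX|].
have : 0 <= m (A `\` B) by apply: (fin_add_prob_ge0 Xm) => x [/AX].
by lra.
Qed.

(** [almost_invariant_seq] replaces the mean by a finite multiset, and [multiset_model] replaces the
    multiset by an index set carrying genuine permutations. *)
Lemma inner_amenable_model (R : realType) (G : groupType) (m : set G -> R)
    (E : seq G) (d : R) :
  fin_add_prob [set x : G | x != 1%g] m ->
  (forall (g : G) (A : set G), A `<=` [set x | x != 1%g] ->
      m [set (x ^ g)%g | x in A] = m A) ->
  0 < d ->
  exists (n : nat) (u : 'I_n -> G * nat), [/\ (0 < n)%N, injective u &
    forall g, g \in E ->
      (exists t : 'S_n,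
        #|[set i | u (t i) != (((u i).1 ^ g)%g, (u i).2)]%SET|%:R <= d * n%:R) /\
      `|#|[set i | (g * (u i).1 == (u i).1 * g)%g]%SET|%:R
         - m (centralizer1 g) * n%:R| <= d * n%:R].
Proof.
move=> Xm m_inv d0; set X := [set x : G | _] in Xm m_inv *.
(* Invariance is given for images and wanted for preimages; conjugation by [g] maps the left-hand
   set onto the right-hand one. *)
have m_al g B : m (X `&` (fun x => x ^ g)%g @^-1` B) = m (X `&` B).
  rewrite -(m_inv g); last by move=> x [].
  congr m; apply/seteqP; split=> [_ [x [x1 Bx] <-]|x [x1 Bx]].
    by split=> //; rewrite /X /= conjg_eq1.
  by exists (x ^ g^-1)%g; rewrite ?conjgKV // /X; split; rewrite /= ?conjgKV ?conjg_eq1.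
have CX g : centralizer1 g `<=` X by move=> x [].
have [s [s0 sX sP]] :=
  almost_invariant_seq Xm (undup_uniq E) m_al CX d0.
have [u [u_inj us cardu uP]] := multiset_model R s.
exists (size s), u; split=> // g gE; have [|al_s C_s] := sP g.
  by rewrite mem_undup.
rewrite !mulr_natr; split.
  have [t tP] := uP _ (conjg_inj g); exists t; apply: le_trans tP _.
  by apply: al_s; exact: undup_uniq.
rewrite (cardu (fun x => g * x == x * g)%g).
(* The points of [s] are nontrivial, so commuting with [g] puts them in [centralizer1 g]. *)
have -> // : count (fun x => g * x == x * g)%g s = count (fun x => x \in centralizer1 g) s.
apply: eq_in_count => x /sX x1; apply/eqP/idP => [gx|/set_mem[]//].
by apply: mem_set; split.
Qed.

Lemma sofic_quotient_by_kernel (R : realType) (G Q : groupType)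
    (p : {multiplicative G -> Q}) (m : set G -> R) :
  fin_add_prob [set x : G | x != 1%g] m ->
  (forall (g : G) (A : set G), A `<=` [set x | x != 1%g] ->
      m [set (x ^ g)%g | x in A] = m A) ->
  (forall q, exists g, p g = q) -> (forall g, p g = 1%g <-> m (centralizer1 g) = 1) ->
  sofic R Q.
Proof.
move=> Xm m_inv p_surj pE; apply: sofic_amplification => F /finite_seqP[s ->].
have p1 : p 1%g = 1%g.
  by apply: (mulgI (p 1%g)); rewrite -gmulfM !mulg1.
have pV g : p g^-1%g = (p g)^-1%g.
  by apply: (mulgI (p g)); rewrite -gmulfM !mulgV p1.
have CX g : centralizer1 g `<=` [set x | x != 1%g] by move=> x [].
(* The lift is normalized at 1, so that the identity permutation models conjugation by [l 1]
   exactly. *)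
have /choice[l lP] q : exists g, p g = q /\ (q = 1%g -> g = 1%g).
  have [->|q1] := eqVneq q 1%g; first by exists 1%g.
  by have [g gq] := p_surj q; exists g; split=> // q1'; rewrite q1' eqxx in q1.
have pl q : p (l q) = q by case: (lP q).
(* For [q != 1] the lift is outside the kernel, so its centralizer has mean less than 1; finiteness
   of [s] makes the bound uniform. *)
have [c c1 cP] : exists2 c : R, c < 1 &
    forall q, q \in s -> q != 1%g -> m (centralizer1 (l q)) <= c.
  elim: s => [|q s [c c1 cP]]; first by exists 0.
  have [->|q1] := eqVneq q 1%g.
    exists c => // r; rewrite inE => /orP[/eqP ->|]; [by rewrite eqxx|exact: cP].
  exists (Num.max c (m (centralizer1 (l q)))) => [|r].
    rewrite gt_max c1 lt_neqAle /= -{2}(fin_add_prob_total Xm).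
    rewrite (fin_add_prob_le Xm) // andbT; apply: contraNneq q1 => mq.
    by rewrite -(pl q); apply/eqP/pE.
  rewrite inE le_max => /orP[/eqP ->|rs r1]; [by rewrite lexx orbT|by rewrite cP].
(* The midpoint leaves room [(1 - c) / 2] for two errors of size [d'] in the fixed-point count; the
   bound [d / 4] pays for the four exceptional sets in the multiplicativity estimate. *)
exists ((c + 1) / 2) => [|d d0]; first by lra.
pose d' := Num.min (d / 4) ((1 - c) / 4).
have d'd : 4 * d' <= d by rewrite /d'; case: (leP (d / 4) ((1 - c) / 4)); lra.
have d'c : 4 * d' <= 1 - c by rewrite /d'; case: (leP (d / 4) ((1 - c) / 4)); lra.
have d'0 : 0 < d' by rewrite lt_min; apply/andP; split; lra.
(* The failure of [l] to be multiplicative lies in the kernel, hence commutes with almost all points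
   of the model. *)
pose defect e f := (l e * l f * (l (e * f))^-1)%g.
pose E := [seq l e | e <- s] ++ [seq l (e * f)%g | e <- s, f <- s] ++
  [seq defect e f | e <- s, f <- s].
have [n [u [n0 u_inj uE]]] := inner_amenable_model E Xm m_inv d'0.
pose bad g (t : 'S_n) := [set i | u (t i) != (((u i).1 ^ g)%g, (u i).2)]%SET.
have /choice[phi phiP] q : exists t : 'S_n, (q = 1%g -> t = 1%g) /\
    (l q \in E -> #|bad (l q) t|%:R <= d' * n%:R).
  have [q1|q1] := eqVneq q 1%g.
    exists 1%g; split=> // _; rewrite (_ : bad _ _ = finset.set0).
      by rewrite cards0 mulr_ge0 // ltW.
    apply/setP => i; rewrite !inE perm1 (lP q).2 // conjg1; apply/negbTE.
    by rewrite negbK; case: (u i) => x k /=.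
  have [lE|lE] := boolP (l q \in E); last first.
    by exists 1%g; split=> // /eqP; rewrite (negPf q1).
  have [[t tP] _] := uE _ lE; exists t; split=> // /eqP; by rewrite (negPf q1).
have bad_le q : l q \in E -> #|bad (l q) (phi q)|%:R <= d' * n%:R by case: (phiP q).
pose com g := [set i | (g * (u i).1 == (u i).1 * g)%g]%SET.
have good g t i : i \notin bad g t -> u (t i) = (((u i).1 ^ g)%g, (u i).2).
  by rewrite inE negbK => /eqP.
exists n, phi; split=> // [e f es fs||e es e1]; last 2 first.
- by apply: (phiP 1%g).1.
- have eE : l e \in E by rewrite !mem_cat map_f.
  (* At a fixed index that is not bad, the point equals its own conjugate by [l e]. *)
  have fix_sub : [set i | phi e i == i]%SET \subset bad (l e) (phi e) :|: com (l e).
    apply/fintype.subsetP => i; rewrite inE => /eqP fixi; rewrite finset.in_setU.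
    have [//|/good] := boolP (i \in bad _ _); rewrite fixi /=.
    by case ui : (u i) => [x k] /= [/esym/conjg_id_commute xe]; rewrite inE ui; apply/eqP.
  have le_nat := leq_trans (subset_leq_card fix_sub) (leq_card_setU _ _).
  rewrite /nfix; move: le_nat; rewrite -(ler_nat R) natrD => /le_trans; apply.
  have := bad_le _ eE; have [_ ] := uE _ eE; rewrite -/(com (l e)).
  rewrite ler_norml => /andP[_].
  have := ler_wpM2r (ler0n R n) (cP e es e1).
  have := ler_wpM2r (ler0n R n) d'c.
  set a := #|com _|%:R; set b := #|bad _ _|%:R; set M := m _; lra.
have eE : l e \in E by rewrite !mem_cat map_f.
have fE : l f \in E by rewrite !mem_cat map_f.
have efE : l (e * f)%g \in E by rewrite !mem_cat allpairs_f ?orbT.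
have dE : defect e f \in E by rewrite !mem_cat allpairs_f ?orbT.
(* Outside [S], conjugating by [l e] and then [l f] amounts to conjugating by the defect, which
   fixes the point, and then by [l (e * f)]. The preimage appears because [phi f] is applied at
   [phi e i]. *)
pose S := bad (l e) (phi e) :|: (phi e @^-1: bad (l f) (phi f)) :|:
  bad (l (e * f)%g) (phi (e * f)%g) :|: ~: com (defect e f).
have fix_sub : ~: S \subset [set i | (phi e * phi f * (phi (e * f))^-1)%g i == i]%SET.
  apply/fintype.subsetP => i; rewrite finset.in_setC !finset.in_setU !negb_or.
  rewrite finset.in_setC negbK => /andP[/andP[/andP[/good ie jf] /good ief]].
  rewrite finset.inE in jf; have {}jf := good _ _ _ jf.
  rewrite !inE !permM => /eqP com_i; apply/eqP/(canLR (permK _)).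
  apply: u_inj; rewrite ief jf.
  rewrite ie /= -conjgM; congr (_, _).
  have -> : (l e * l f = defect e f * l (e * f))%g by rewrite /defect mulgVK.
  by rewrite conjgM; congr (_ ^ _)%g; apply/conjg_id_commute.
have mdef : m (centralizer1 (defect e f)) = 1.
  by apply/pE; rewrite /defect !gmulfM pV !pl mulgV.
have [_ /=] := uE _ dE; rewrite mdef mul1r -/(com (defect e f)) ler_norml => /andP[com_ge _].
have cardS : (#|S| <= #|bad (l e) (phi e)| + #|bad (l f) (phi f)| +
    #|bad (l (e * f)%g) (phi (e * f)%g)| + #|~: com (defect e f)|)%N.
  apply: leq_trans (leq_card_setU _ _) _; rewrite leq_add2r.
  apply: leq_trans (leq_card_setU _ _) _; rewrite leq_add2r.
  apply: leq_trans (leq_card_setU _ _) _; rewrite leq_add2l.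
  by rewrite card_preimset //; exact: perm_inj.
have := subset_leq_card fix_sub; move: cardS; rewrite -/(nfix _).
have : (#|S| + #|~: S| = n)%N by rewrite cardsC card_ord.
have : (#|com (defect e f)| + #|~: com (defect e f)| = n)%N by rewrite cardsC card_ord.
move=> /(congr1 (fun k => k%:R : R)) + /(congr1 (fun k => k%:R : R)).
rewrite -!(ler_nat R) !natrD.
have := bad_le _ eE; have := bad_le _ fE; have := bad_le _ efE.
have := ler_wpM2r (ler0n R n) d'd.
lra.
Qed.

(** * The dichotomy between centralizers of mean 1 and a proper kernel *)

Lemma almost_commutative_of_mean1 (R : realType) (G : groupType) (m : set G -> R) :
  fin_add_prob [set x : G | x != 1%g] m ->
  (forall g, m (centralizer1 g) = 1) -> almost_commutative G.
Proof.
move=> Xm mC A /finite_seqP[s ->].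
pose D (s : seq G) := [set x : G | x != 1%g /\ forall a, a \in s -> commute a x].
have mD : m (D s) = 1.
  elim: s => [|a s IHs].
    rewrite -(fin_add_prob_total Xm); congr m; apply/seteqP.
    by split=> x; [case|split].
  rewrite (_ : D (a :: s) = centralizer1 a `&` D s).
    by apply: (fin_add_prob_setI1 Xm) => // x [].
  apply/seteqP; split=> x.
    move=> [x1 xs]; split; split=> //; first by apply: xs; rewrite inE eqxx.
    by move=> b bs; apply: xs; rewrite inE bs orbT.
  move=> [[x1 ax] [_ xs]]; split=> // b; rewrite inE => /orP[/eqP -> //|]; exact: xs.
have [[b [b1 bs]]|D0] := pselect (exists b, D s b); first by exists b.
have Ds0 : D s = set0 by apply/seteqP; split=> // x Dx; case: D0; exists x.
by have := mD; rewrite Ds0 (fin_add_prob_set0 Xm); lra.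
Qed.

Theorem corollary5p2 (R : realType) (Gamma : groupType) :
  inner_amenable R Gamma ->
  has_nontrivial_sofic_quotient R Gamma \/ almost_commutative Gamma.
Proof.
move=> [m Xm m_inv].
have [allC|[g0 g0C]] : (forall g, m (centralizer1 g) = 1) \/
    exists g, m (centralizer1 g) <> 1.
- have [|/existsNP] := pselect (forall g, m (centralizer1 g) = 1); first by left.
  by right.
- by right; exact: almost_commutative_of_mean1 Xm allC.
left; have CX g : centralizer1 g `<=` [set x : Gamma | x != 1%g] by move=> x [].
pose N : pred Gamma := fun g => `[< m (centralizer1 g) = 1 >].
have N1 : N 1%g.
  apply/asboolP; rewrite -(fin_add_prob_total Xm); congr m; apply/seteqP.
  by split=> x; [case|split=> //; rewrite /commute mul1g mulg1].
(* What commutes with [x] and [y] commutes with [x * y^-1], and an intersection of two sets of mean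
   1 has mean 1. *)
have ND x y : N x -> N y -> N (x * y^-1)%g.
  move=> /asboolP Nx /asboolP Ny; apply/asboolP/eqP; rewrite eq_le.
  rewrite -{1}(fin_add_prob_total Xm) (fin_add_prob_le Xm) //=.
  rewrite -(fin_add_prob_setI1 Xm (CX x) (CX y) Nx Ny).
  apply: (fin_add_prob_le Xm) => // z [[z1 /commute_sym xz] [_ /commute_sym yz]].
  by split=> //; apply/commute_sym/commuteM/commuteV.
(* The centralizer of [x ^ g] is the conjugate by [g] of that of [x], so invariance of [m]
   applies. *)
have NJ x g : N x -> N (x ^ g)%g.
  move=> /asboolP Nx; apply/asboolP; rewrite -Nx -(m_inv g _ (CX x)); congr m.
  apply/seteqP; split=> [y [y1 xy]|_ [y [y1 xy] <-]].
    exists (y ^ g^-1)%g; rewrite ?conjgKV //; split; rewrite ?conjg_eq1 //.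
    apply: (@conjg_inj _ g).
    by rewrite [LHS]conjMg [RHS]conjMg !conjgKV.
  by split; rewrite ?conjg_eq1 // /commute -!conjMg xy.
have [Q [p [p_surj pE]]] := quotient_group_exists N1 ND NJ.
have p1 : p 1%g = 1%g.
  by apply: (mulgI (p 1%g)); rewrite -gmulfM !mulg1.
have pN g : p g = 1%g <-> m (centralizer1 g) = 1.
  have := pE g 1%g; rewrite p1 invg1 mulg1 => ->.
  by split=> /asboolP.
exists Q, p; split=> //; last exact: sofic_quotient_by_kernel Xm m_inv p_surj pN.
by exists (p g0); apply/eqP => /pN.
Qed.
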